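(* Let $u\in\mathbb{R}^n$ have all entries positive and $\alpha_u>0$. Let $\|C^sx+\xi^s\|\le l_s(x,z)$ be a GSOC constraint with $C^s\in\mathbb{R}^{p\times n}$, $\xi^s\in\mathbb{R}^p$, $l_s(x,z)=(\zeta^s)^Tx+(\eta^s)^Tz+\theta^s$, and put $h^s(x)=C^sx+\xi^s$. Let $x\in\mathbb{R}^n$ with $x\ge0$ and $\alpha_u\ge u^Tx$, $z\in\mathbb{R}^{\mathcal{N}}$, $X$ a symmetric $n\times n$ matrix, $S\in\mathbb{R}^{n\times\mathcal{N}}$. The KSOC constraint generated by linearizing the Kronecker product $$\begin{pmatrix}l_s(x,z)I&h^s(x)\\ (h^s(x))^T&l_s(x,z)\end{pmatrix}\otimes\begin{pmatrix}\mathrm{diag}(u)\mathrm{diag}(x)&\mathrm{diag}(u)x\\ x^T\mathrm{diag}(u)&\alpha_u\end{pmatrix},$$ namely $$\begin{pmatrix}\Lambda&&&G_1\\ &\ddots&&\vdots\\ &&\Lambda&G_p\\ G_1^T&\cdots&G_p^T&\Lambda\end{pmatrix}\succeq0$$ (with $p+1$ diagonal blocks $\Lambda$; $\Lambda$ and $G_j$ as in the context), is dominated by the GSRT constraints generated by $x\ge0$, $\alpha_u\ge u^Tx$ and $\|C^sx+\xi^s\|\le l_s(x,z)$; that is, it holds whenever, with $\lambda=X\zeta^s+S\eta^s+\theta^sx$, $$\|C^sX_{\cdot,j}+x_j\xi^s\|\le\lambda_j\quad(j=1,\dots,n),\qquad\left\|\alpha_u(C^sx+\xi^s)-C^sXu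-(u^Tx)\xi^s\right\|\le\alpha_ul_s(x,z)-u^T\lambda.$$
   Context: $\mathrm{diag}(v)$ is the diagonal matrix with diagonal $v$; $X_{\cdot,j}$ is the $j$-th column of $X$; $C^s_{j,\cdot}$ is the $j$-th row of $C^s$; $\|\cdot\|$ is the Euclidean norm; $Q^{\dagger}$ is the Moore-Penrose pseudoinverse. Linearization means replacing $xx^T$ by $X$ and $xz^T$ by $S$. With $\lambda=X\zeta^s+S\eta^s+\theta^sx\in\mathbb{R}^n$ (linearization of $l_s(x,z)x$) and $g_j=X(C^s_{j,\cdot})^T+\xi^s_jx\in\mathbb{R}^n$ (linearization of $h^s_j(x)x$), define $$\Lambda=\begin{pmatrix}\mathrm{diag}(u)\mathrm{diag}(\lambda)&\mathrm{diag}(u)\lambda\\ \lambda^T\mathrm{diag}(u)&\alpha_ul_s(x,z)\end{pmatrix},\qquad G_j=\begin{pmatrix}\mathrm{diag}(u)\mathrm{diag}(g_j)&\mathrm{diag}(u)g_j\\ g_j^T\mathrm{diag}(u)&\alpha_u(C^s_{j,\cdot}x+\xi^s_j)\end{pmatrix},\quad j=1,\dots,p.$$ A constraint is dominated by a set of constraints if it is implied by them. GSOC constraints: consider quadratic constraints $x^TQ_ix+c_i^Tx+d_i\le0$, $i=1,\dots,l$ ($Q_i$ symmetric $n\times n$), $\mathcal{C}=\{i:Q_i\succeq0\}$, $\mathcal{N}$ the remaining indices, and a vector $z\in\mathbb{R}^{\mathcal{N}}$ of auxiliary variables. For $i\in\mathcal{C}$ write $Q_i=B_i^TB_i$; for $i\in\mathcal{N}$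 write $Q_i=L_i^TL_i-M_i^TM_i$ where $L_i$ and $M_i$ come from the positive and negative eigenvalues of $Q_i$. A general SOC (GSOC) constraint is one of the following second order cone constraints, written in the form $\|C^sx+\xi^s\|\le l_s(x,z)$ with $l_s$ affine (where $p_i=\tfrac12Q_i^{\dagger}c_i$ and $\delta_i=\tfrac14c_i^TQ_i^{\dagger}c_i-d_i$): - for $i\in\mathcal{C}$: $\left\|\begin{pmatrix}B_ix\\ \frac12(-d_i-c_i^Tx-1)\end{pmatrix}\right\|\le\tfrac12(-d_i-c_i^Tx+1)$; or, if $c_i\in\mathrm{Range}(Q_i)$ and $\delta_i\ge0$, $\|B_i(x+p_i)\|\le\sqrt{\delta_i}$; - for $i\in\mathcal{N}$: $\left\|\begin{pmatrix}L_ix\\ \frac12(c_i^Tx+d_i+1)\end{pmatrix}\right\|\le z_i$ or $\left\|\begin{pmatrix}M_ix\\ \frac12(c_i^Tx+d_i-1)\end{pmatrix}\right\|\le z_i$; or, if $c_i\in\mathrm{Range}(Q_i)$ and $\delta_i>0$, $\|L_i(x+p_i)\|\le z_i$ or $\left\|\begin{pmatrix}M_i(x+p_i)\\ \sqrt{\delta_i}\end{pmatrix}\right\|\le z_i$; or, if $c_i\in\mathrm{Range}(Q_i)$ and $\delta_i\le0$, $\left\|\begin{pmatrix}L_i(x+p_i)\\ \sqrt{-\delta_i}\end{pmatrix}\right\|\le z_i$ or $\|M_i(x+p_i)\|\le z_i$. *)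

(* Defs.v *)
From mathcomp Require Import all_boot all_order all_algebra.
From mathcomp Require Import boolp reals.

Set Implicit Arguments.
Unset Strict Implicit.
Unset Printing Implicit Defensive.

Import Order.TTheory GRing.Theory Num.Theory.
Local Open Scope ring_scope.

Definition dot (R : realType) n (u v : 'cV[R]_n) : R := (u^T *m v) 0 0.

Definition enorm (R : realType) n (v : 'cV[R]_n) : R :=
  Num.sqrt (\sum_i v i 0 ^+ 2).

Definition psd (R : realType) n (A : 'M[R]_n) : Prop :=
  A^T = A /\ forall v : 'cV[R]_n, 0 <= dot v (A *m v).

(* [P] is the Moore-Penrose pseudoinverse of [A], given by the Penrose
   equations, which determine [P] uniquely. *)
Definition is_pseudoinverse (R : realType) m n
    (A : 'M[R]_(m, n)) (P : 'M[R]_(n, m)) : Prop :=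
  [/\ A *m P *m A = A, P *m A *m P = P,
      (A *m P)^T = A *m P & (P *m A)^T = P *m A].

Definition in_range (R : realType) m n (A : 'M[R]_(m, n)) (c : 'cV[R]_m) :
    Prop :=
  exists w : 'cV[R]_n, c = A *m w.

(* [L] and [M] come from the positive, resp. negative, eigenvalues of [Q]:
   [L^T L] and [M^T M] are the positive and negative parts of a spectral
   decomposition of [Q] (whose orthonormal eigenvectors are the rows of [V]),
   so that [Q = L^T L - M^T M].  The choice of [L] with rows
   [sqrt (lam j) * v_j], one for each [lam j > 0], is one instance; the number
   of rows is left free. *)
Definition eigen_split (R : realType) n a b
    (Q : 'M[R]_n) (L : 'M[R]_(a, n)) (M : 'M[R]_(b, n)) : Prop :=
  exists (V : 'M[R]_n) (lam : 'rV[R]_n),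
    [/\ V *m V^T = 1%:M,
        Q = V^T *m diag_mx lam *m V,
        L^T *m L = V^T *m diag_mx (\row_j Num.max (lam 0 j) 0) *m V &
        M^T *m M = V^T *m diag_mx (\row_j Num.max (- lam 0 j) 0) *m V].

Definition nonconvex (R : realType) n l (Q : 'I_l -> 'M[R]_n) : {set 'I_l} :=
  [set i | ~~ `[< psd (Q i) >]].

(* Vectors indexed by [nonconvex Q] are column vectors of size
   [#|nonconvex Q|]; their [k]-th entry belongs to the constraint
   [enum_val k]. *)
Definition nc_index (R : realType) n l (Q : 'I_l -> 'M[R]_n)
    (k : 'I_#|nonconvex Q|) : 'I_l :=
  enum_val k.

Section GSOC.
Variables (R : realType) (n l : nat).
Variables (Q : 'I_l -> 'M[R]_n) (c : 'I_l -> 'cV[R]_n) (d : 'I_l -> R).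

Let N := #|nonconvex Q|.

(* For [P] the pseudoinverse of [Q i], these are [p_i] and [delta_i]. *)
Definition center (P : 'M[R]_n) (i : 'I_l) : 'cV[R]_n := 2^-1 *: (P *m c i).
Definition delta (P : 'M[R]_n) (i : 'I_l) : R :=
  4^-1 * dot (c i) (P *m c i) - d i.

(* [gsoc_form h f]: the constraint [enorm (h x) <= f x z] is one of the GSOC
   constraints. *)
Inductive gsoc_form :
    forall p : nat, ('cV[R]_n -> 'cV[R]_p) -> ('cV[R]_n -> 'cV[R]_N -> R) ->
      Prop :=
| GsocConvex (i : 'I_l) (r : nat) (B : 'M[R]_(r, n)) :
    psd (Q i) -> Q i = B^T *m B ->
    gsoc_form
      (fun x => col_mx (B *m x) (2^-1 * (- d i - dot (c i) x - 1))%:M)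
      (fun x _ => 2^-1 * (- d i - dot (c i) x + 1))
| GsocConvexCentered (i : 'I_l) (r : nat) (B : 'M[R]_(r, n)) (P : 'M[R]_n) :
    psd (Q i) -> Q i = B^T *m B -> is_pseudoinverse (Q i) P ->
    in_range (Q i) (c i) -> 0 <= delta P i ->
    gsoc_form
      (fun x => B *m (x + center P i))
      (fun _ _ => Num.sqrt (delta P i))
| GsocPos (k : 'I_N) (a b : nat) (L : 'M[R]_(a, n)) (M : 'M[R]_(b, n)) :
    let i := nc_index k in
    eigen_split (Q i) L M ->
    gsoc_form
      (fun x => col_mx (L *m x) (2^-1 * (dot (c i) x + d i + 1))%:M)
      (fun _ z => z k 0)
| GsocNeg (k : 'I_N) (a b : nat) (L : 'M[R]_(a, n)) (M : 'M[R]_(b, n)) :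
    let i := nc_index k in
    eigen_split (Q i) L M ->
    gsoc_form
      (fun x => col_mx (M *m x) (2^-1 * (dot (c i) x + d i - 1))%:M)
      (fun _ z => z k 0)
| GsocPosCenteredGt (k : 'I_N) (a b : nat)
    (L : 'M[R]_(a, n)) (M : 'M[R]_(b, n)) (P : 'M[R]_n) :
    let i := nc_index k in
    eigen_split (Q i) L M -> is_pseudoinverse (Q i) P ->
    in_range (Q i) (c i) -> 0 < delta P i ->
    gsoc_form
      (fun x => L *m (x + center P i))
      (fun _ z => z k 0)
| GsocNegCenteredGt (k : 'I_N) (a b : nat)
    (L : 'M[R]_(a, n)) (M : 'M[R]_(b, n)) (P : 'M[R]_n) :
    let i := nc_index k in
    eigen_split (Q i) L M -> is_pseudoinverse (Q i) P ->
    in_range (Q i) (c i) -> 0 < delta P i ->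
    gsoc_form
      (fun x => col_mx (M *m (x + center P i)) (Num.sqrt (delta P i))%:M)
      (fun _ z => z k 0)
| GsocPosCenteredLe (k : 'I_N) (a b : nat)
    (L : 'M[R]_(a, n)) (M : 'M[R]_(b, n)) (P : 'M[R]_n) :
    let i := nc_index k in
    eigen_split (Q i) L M -> is_pseudoinverse (Q i) P ->
    in_range (Q i) (c i) -> delta P i <= 0 ->
    gsoc_form
      (fun x => col_mx (L *m (x + center P i)) (Num.sqrt (- delta P i))%:M)
      (fun _ z => z k 0)
| GsocNegCenteredLe (k : 'I_N) (a b : nat)
    (L : 'M[R]_(a, n)) (M : 'M[R]_(b, n)) (P : 'M[R]_n) :
    let i := nc_index k in
    eigen_split (Q i) L M -> is_pseudoinverse (Q i) P ->
    in_range (Q i) (c i) -> delta P i <= 0 ->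
    gsoc_form
      (fun x => M *m (x + center P i))
      (fun _ z => z k 0).

End GSOC.

Definition affine_l (R : realType) n N
    (zeta : 'cV[R]_n) (eta : 'cV[R]_N) (theta : R)
    (x : 'cV[R]_n) (z : 'cV[R]_N) : R :=
  dot zeta x + dot eta z + theta.

Definition is_gsoc (R : realType) n l
    (Q : 'I_l -> 'M[R]_n) (c : 'I_l -> 'cV[R]_n) (d : 'I_l -> R)
    p (C : 'M[R]_(p, n)) (xi : 'cV[R]_p)
    (zeta : 'cV[R]_n) (eta : 'cV[R]_#|nonconvex Q|) (theta : R) : Prop :=
  exists h f, [/\ gsoc_form c d h f,
    forall x, C *m x + xi = h x &
    forall x z, affine_l zeta eta theta x z = f x z].

(* The linearizations of [l_s(x,z) x] and [h_j(x) x]. *)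
Definition lin_lx (R : realType) n N
    (zeta : 'cV[R]_n) (eta : 'cV[R]_N) (theta : R)
    (x : 'cV[R]_n) (X : 'M[R]_n) (S : 'M[R]_(n, N)) : 'cV[R]_n :=
  X *m zeta + S *m eta + theta *: x.

Definition lin_hx (R : realType) n p (C : 'M[R]_(p, n)) (xi : 'cV[R]_p)
    (x : 'cV[R]_n) (X : 'M[R]_n) (j : 'I_p) : 'cV[R]_n :=
  X *m (row j C)^T + xi j 0 *: x.

(* [[diag u * diag w, diag u * w], [w^T * diag u, s]]: with [w = x] and
   [s = alpha] the right factor of the Kronecker product; with the linearized
   products it gives the blocks [Lambda] and [G_j]. *)
Definition arrow_block (R : realType) n (u w : 'cV[R]_n) (s : R) :
    'M[R]_(n + 1) :=
  block_mx (diag_mx u^T *m diag_mx w^T) (diag_mx u^T *m w)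
           (w^T *m diag_mx u^T)         s%:M.

Definition Lambda_block (R : realType) n N (u : 'cV[R]_n) (alpha : R)
    (zeta : 'cV[R]_n) (eta : 'cV[R]_N) (theta : R)
    (x : 'cV[R]_n) (z : 'cV[R]_N) (X : 'M[R]_n) (S : 'M[R]_(n, N)) :
    'M[R]_(n + 1) :=
  arrow_block u (lin_lx zeta eta theta x X S)
    (alpha * affine_l zeta eta theta x z).

Definition G_block (R : realType) n p (u : 'cV[R]_n) (alpha : R)
    (C : 'M[R]_(p, n)) (xi : 'cV[R]_p)
    (x : 'cV[R]_n) (X : 'M[R]_n) (j : 'I_p) : 'M[R]_(n + 1) :=
  arrow_block u (lin_hx C xi x X j) (alpha * ((row j C *m x) 0 0 + xi j 0)).

Definition ksoc_mx (R : realType) n N p (u : 'cV[R]_n) (alpha : R)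
    (C : 'M[R]_(p, n)) (xi : 'cV[R]_p)
    (zeta : 'cV[R]_n) (eta : 'cV[R]_N) (theta : R)
    (x : 'cV[R]_n) (z : 'cV[R]_N) (X : 'M[R]_n) (S : 'M[R]_(n, N)) :
    'M[R]_(\sum_(j < p) (n + 1) + (n + 1)) :=
  let Lam := Lambda_block u alpha zeta eta theta x z X S in
  let G := G_block u alpha C xi x X in
  block_mx (\mxdiag_(j < p) Lam)    (\mxcol_(j < p) G j)
           (\mxrow_(j < p) (G j)^T) Lam.

(* Before linearization, that is for [X = x x^T] and [S = x z^T], the blocks of
   [ksoc_mx] are those of the Kronecker product
   [[l I, h], [h^T, l]] (x) [arrow_block u x alpha]. *)
Section Kronecker.
Variables (R : realType) (n N p : nat) (u : 'cV[R]_n) (alpha : R).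
Variables (C : 'M[R]_(p, n)) (xi : 'cV[R]_p).
Variables (zeta : 'cV[R]_n) (eta : 'cV[R]_N) (theta : R).
Variables (x : 'cV[R]_n) (z : 'cV[R]_N).

Lemma arrow_block_scale (a : R) (w : 'cV[R]_n) (s : R) :
  arrow_block u (a *: w) (s * a) = a *: arrow_block u w s.
Proof.
rewrite /arrow_block scale_block_mx !linearZ /= -?scalemxAl -?scalemxAr.
by rewrite scale_scalar_mx mulrC.
Qed.

Lemma mulmx_dot (w v : 'cV[R]_n) m (t y : 'cV[R]_m) :
  w *m t^T *m y = dot t y *: w.
Proof. by rewrite -mulmxA [t^T *m y]mx11_scalar mul_mx_scalar. Qed.

Lemma Lambda_blockE :
  Lambda_block u alpha zeta eta theta x z (x *m x^T) (x *m z^T)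
  = affine_l zeta eta theta x z *: arrow_block u x alpha.
Proof.
rewrite -arrow_block_scale /Lambda_block /lin_lx !mulmx_dot //.
have dotC m (a b : 'cV[R]_m) : dot a b = dot b a.
  by rewrite /dot -[in RHS](trmxK a) -trmx_mul [in RHS]mxE.
by rewrite (dotC _ x) (dotC _ z) -!scalerDl.
Qed.

Lemma G_blockE (j : 'I_p) :
  G_block u alpha C xi x (x *m x^T) j
  = (C *m x + xi) j 0 *: arrow_block u x alpha.
Proof.
rewrite -arrow_block_scale /G_block /lin_hx mulmx_dot // -scalerDl.
have -> : dot x (row j C)^T = (row j C *m x) 0 0.
  by rewrite /dot -trmx_mul mxE.
by rewrite -row_mul !mxE.
Qed.

End Kronecker.

(* Main.v *)
Require Import Defs.
From mathcomp Require Import all_boot all_order all_algebra.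
From mathcomp Require Import boolp reals.
From mathcomp Require Import ring.

(** The arrow block with parameters [w] and [s] is the matrix of the bilinear
    form
      [(y, t), (y', t') |->
         \sum_i u_i w_i (y_i + t) (y'_i + t') + (s - u^T w) t t'],
    so the change of variables [y_i := y_i + t] makes it diagonal
    ([dot_arrow_block]).  This change of variables depends on neither [w] nor
    [s]: it diagonalizes all the blocks of the KSOC matrix at once.  The
    quadratic form of the whole matrix, evaluated at [p] vectors [a_j] and a
    vector [b], therefore splits into [n + 1] independent quadratic forms, one
    per diagonal coordinate, each of the shape
      [m (\sum_j a_j^2 + b^2) + 2 b (\sum_j h_j a_j)],
    that is, the form of the arrow matrix [[m I, h], [h^T, m]].  Such a form is
    nonnegative when [h] and [m] satisfy the second order cone constraint
    [enorm h <= m] ([soc_form_ge0]).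

    In the coordinate [i < n], weighted by [u_i > 0], the vector [h] collects
    the entries [g_j i], which by symmetry of [X] is [C X_i + x_i xi], and [m]
    is [lambda_i]: this cone constraint is the GSRT constraint generated by
    [x_i >= 0].  In the last coordinate [h_j] is
    [alpha (C x + xi)_j - u^T g_j] and [m] is [alpha l - u^T lambda]: this is
    the GSRT constraint generated by [u^T x <= alpha]. *)

Set Implicit Arguments.
Unset Strict Implicit.
Unset Printing Implicit Defensive.

Import Order.TTheory GRing.Theory Num.Theory.
Local Open Scope ring_scope.

Lemma dotE (R : realType) n (a b : 'cV[R]_n) :
  dot a b = \sum_i a i 0 * b i 0.
Proof. by rewrite /dot mxE; apply: eq_bigr => i _; rewrite mxE. Qed.

(** The form is that of the arrow matrix [[m I, h], [h^T, m]].  The cone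
    constraint bounds its cross term: by Cauchy-Schwarz
    [|2 b h^T a| <= 2 |h| |b| |a| <= m (|a|^2 + b^2)]. *)
Lemma soc_form_ge0 (R : realType) p (h : 'cV[R]_p) (m : R)
    (a : 'I_p -> R) (b : R) :
  enorm h <= m ->
  0 <= m * (\sum_j a j ^+ 2 + b ^+ 2) + 2 * (b * \sum_j h j 0 * a j).
Proof.
move=> le_hm.
have m_ge0 : 0 <= m by apply: le_trans le_hm; exact: sqrtr_ge0.
have h2_ge0 : 0 <= \sum_j h j 0 ^+ 2 by apply: sumr_ge0 => j _; exact: sqr_ge0.
have h2_le : \sum_j h j 0 ^+ 2 <= m ^+ 2.
  rewrite -(sqr_sqrtr h2_ge0); apply: lerXn2r => //; rewrite nnegrE //.
  exact: sqrtr_ge0.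
(* If [m = 0] then [h = 0] and the form vanishes. *)
have [m_gt0|m_le0] := ltP 0 m; last first.
  have m0 : m = 0 by apply/eqP; rewrite eq_le m_le0.
  have h0 j : h j 0 = 0.
    apply/eqP; rewrite -sqrf_eq0; apply/eqP.
    have /eqP : \sum_j h j 0 ^+ 2 = 0.
      by apply/eqP; rewrite eq_le h2_ge0 andbT (le_trans h2_le) // m0 expr0n.
    rewrite psumr_eq0 => [/allP/(_ j)/=|i _]; last exact: sqr_ge0.
    by rewrite mem_index_enum => /(_ isT)/eqP.
  rewrite m0 mul0r add0r big1 ?mulr0 // => j _.
  by rewrite h0 mul0r.
rewrite -(pmulr_rge0 _ m_gt0).
(* Complete the squares in the [a j], after scaling the form by [m > 0]. *)
have -> : m * (m * (\sum_j a j ^+ 2 + b ^+ 2) + 2 * (b * \sum_j h j 0 * a j))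
    = \sum_j (m * a j + b * h j 0) ^+ 2
      + b ^+ 2 * (m ^+ 2 - \sum_j h j 0 ^+ 2).
  have -> : \sum_j (m * a j + b * h j 0) ^+ 2
      = m ^+ 2 * \sum_j a j ^+ 2 + b ^+ 2 * \sum_j h j 0 ^+ 2
        + 2 * m * b * \sum_j h j 0 * a j.
    rewrite !mulr_sumr -!big_split /=; apply: eq_bigr => j _; ring.
  ring.
apply: addr_ge0; first by apply: sumr_ge0 => j _; exact: sqr_ge0.
by rewrite mulr_ge0 ?sqr_ge0 ?subr_ge0.
Qed.

Lemma arrow_block_sym (R : realType) n (u w : 'cV[R]_n) (s : R) :
  (arrow_block u w s)^T = arrow_block u w s.
Proof.
rewrite /arrow_block tr_block_mx !trmx_mul !tr_diag_mx trmxK tr_scalar_mx.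
by rewrite diag_mxC.
Qed.

(** An arrow block is diagonal in the coordinates [(y_i + t)_i, t] of [(y, t)],
    whatever [w] and [s] are. *)
Lemma dot_arrow_block (R : realType) n (u w : 'cV[R]_n) (s : R)
    (a b : 'cV[R]_(n + 1)) :
  dot a (arrow_block u w s *m b) =
    \sum_i u i 0 * (w i 0 * ((usubmx a i 0 + dsubmx a 0 0)
                             * (usubmx b i 0 + dsubmx b 0 0)))
    + (s - dot u w) * (dsubmx a 0 0 * dsubmx b 0 0).
Proof.
rewrite -[in LHS](vsubmxK a) -[in LHS](vsubmxK b).
move: (usubmx a) (dsubmx a) (usubmx b) (dsubmx b) => y t y' t'.
rewrite /arrow_block mul_block_col /dot tr_col_mx mul_row_col mulmxDr.
have e00 (A B : 'M[R]_1) : (A + B) 0 0 = A 0 0 + B 0 0 by rewrite mxE.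
rewrite !e00 -!mulmxA !mul_diag_mx mulmxDr e00.
rewrite mul_scalar_mx -!/(dot _ _) !dotE !big_ord1 -/(dot w _) !mxE.
rewrite mulrBl mulr_suml dotE !mulr_sumr [RHS]addrCA -sumrB.
rewrite addrA -!big_split /= addrC; congr (_ + _); first by rewrite mulrCA.
by apply: eq_bigr => i _; rewrite !mxE big_ord1; ring.
Qed.

Lemma psd_arrowhead (R : realType) p m (L : 'M[R]_m) (G : 'I_p -> 'M[R]_m) :
  L^T = L ->
  (forall (a : 'I_p -> 'cV[R]_m) (b : 'cV[R]_m),
     0 <= \sum_j dot (a j) (L *m a j) + dot b (L *m b)
          + 2 * \sum_j dot (a j) (G j *m b)) ->
  psd (block_mx (\mxdiag_(j < p) L)    (\mxcol_(j < p) G j)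
                (\mxrow_(j < p) (G j)^T) L).
Proof.
move=> L_sym ge0; split.
  rewrite tr_block_mx tr_mxdiag tr_mxcol tr_mxrow L_sym.
  by congr block_mx; apply/eq_mxcol => j; rewrite trmxK.
move=> v; rewrite -(vsubmxK v); set b := dsubmx v.
rewrite -(submxcolK (usubmx v)).
pose a : 'I_p -> 'cV[R]_m := fun j => submxcol (usubmx v) j.
rewrite -[X in col_mx X]/(\mxcol_j a j).
set A := block_mx _ _ _ _.
suff -> : dot (col_mx (\mxcol_j a j) b) (A *m col_mx (\mxcol_j a j) b)
    = \sum_j dot (a j) (L *m a j) + dot b (L *m b)
      + 2 * \sum_j dot (a j) (G j *m b).
  exact: ge0.
rewrite {}/A mul_block_col mul_mxdiag_mxcol mxcol_mul mul_mxrow_mxcol.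
rewrite /dot tr_col_mx tr_mxcol mul_row_col !mulmxDr !mul_mxrow_mxcol.
rewrite mulmx_sumr.
have cross j : (b^T *m ((G j)^T *m a j)) 0 0 = ((a j)^T *m (G j *m b)) 0 0.
  have -> : b^T *m ((G j)^T *m a j) = ((a j)^T *m (G j *m b))^T.
    by rewrite !trmx_mul trmxK mulmxA.
  by rewrite mxE.
have e00 (A B : 'M[R]_1) : (A + B) 0 0 = A 0 0 + B 0 0 by rewrite mxE.
rewrite !e00 !summxE.
under [X in _ + (X + _)]eq_bigr do rewrite cross.
ring.
Qed.

(** The blocks are diagonal in common coordinates, where the coefficients of
    [arrow_block u (g j) (r j)] are the [u_i (g j)_i] and [r j - u^T (g j)].
    Each coordinate thus contributes the form of [soc_form_ge0], scaled by
    [u_i] in the coordinate [i < n], and the hypotheses are its cone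
    constraints. *)
Lemma psd_arrow_blocks (R : realType) n p (u w : 'cV[R]_n) (s : R)
    (g : 'I_p -> 'cV[R]_n) (r : 'I_p -> R) :
  (forall i, 0 <= u i 0) ->
  (forall i, enorm (\col_j g j i 0) <= w i 0) ->
  enorm (\col_j (r j - dot u (g j))) <= s - dot u w ->
  psd (block_mx
         (\mxdiag_(j < p) arrow_block u w s)
         (\mxcol_(j < p) arrow_block u (g j) (r j))
         (\mxrow_(j < p) (arrow_block u (g j) (r j))^T)
         (arrow_block u w s)).
Proof.
move=> u_ge0 soc_w soc_s; apply: psd_arrowhead; first exact: arrow_block_sym.
move=> a b; rewrite dot_arrow_block.
under eq_bigr do rewrite dot_arrow_block.
under [X in _ + 2 * X]eq_bigr do rewrite dot_arrow_block.
pose y j i := usubmx (a j) i 0 + dsubmx (a j) 0 0.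
pose t j := dsubmx (a j) 0 0.
pose y0 i := usubmx b i 0 + dsubmx b 0 0.
pose t0 := dsubmx b 0 0.
(* Regroup the block-wise sums by diagonal coordinate. *)
suff -> : \sum_j (\sum_i u i 0 * (w i 0 * (y j i * y j i))
                  + (s - dot u w) * (t j * t j))
     + (\sum_i u i 0 * (w i 0 * (y0 i * y0 i)) + (s - dot u w) * (t0 * t0))
     + 2 * \sum_j (\sum_i u i 0 * (g j i 0 * (y j i * y0 i))
                   + (r j - dot u (g j)) * (t j * t0))
   = \sum_i u i 0 * (w i 0 * (\sum_j y j i ^+ 2 + y0 i ^+ 2)
        + 2 * (y0 i * \sum_j (\col_j g j i 0) j 0 * y j i))
     + ((s - dot u w) * (\sum_j t j ^+ 2 + t0 ^+ 2)
        + 2 * (t0 * \sum_j (\col_j (r j - dot u (g j))) j 0 * t j)).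
  apply: addr_ge0; last exact: soc_form_ge0.
  by apply: sumr_ge0 => i _; rewrite mulr_ge0 //; exact: soc_form_ge0.
have -> : \sum_i u i 0 * (w i 0 * (\sum_j y j i ^+ 2 + y0 i ^+ 2)
        + 2 * (y0 i * \sum_j (\col_j g j i 0) j 0 * y j i))
   = \sum_j \sum_i u i 0 * (w i 0 * (y j i * y j i))
     + \sum_i u i 0 * (w i 0 * (y0 i * y0 i))
     + 2 * \sum_j \sum_i u i 0 * (g j i 0 * (y j i * y0 i)).
  rewrite exchange_big [X in 2 * X]exchange_big /= mulr_sumr -!big_split /=.
  apply: eq_bigr => i _; rewrite mulrDr mulrDr mulrDr !mulr_sumr.
  by congr (_ + _ + _); apply: eq_bigr => j _; rewrite ?mxE; ring.
rewrite !big_split /= -!mulr_sumr.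
have -> : t0 * (\sum_j (\col_j (r j - dot u (g j))) j 0 * t j)
        = \sum_j (r j - dot u (g j)) * (t j * t0).
  by rewrite mulr_sumr; apply: eq_bigr => j _; rewrite mxE; ring.
rewrite -(eq_bigr _ (fun j _ => esym (expr2 (t j)))).
ring.
Qed.

Lemma col_lin_hx (R : realType) n p (C : 'M[R]_(p, n)) (xi : 'cV[R]_p)
    (x : 'cV[R]_n) (X : 'M[R]_n) (i : 'I_n) :
  X^T = X ->
  \col_j lin_hx C xi x X j i 0 = C *m col i X + x i 0 *: xi.
Proof.
move=> X_sym; apply/colP => j; rewrite !mxE (mulrC (x i 0)); congr (_ + _).
by apply: eq_bigr => k _; rewrite !mxE mulrC -[in LHS]X_sym mxE.
Qed.

Lemma dot_lin_hx (R : realType) n p (u : 'cV[R]_n) (C : 'M[R]_(p, n))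
    (xi : 'cV[R]_p) (x : 'cV[R]_n) (X : 'M[R]_n) (j : 'I_p) :
  X^T = X ->
  dot u (lin_hx C xi x X j) = (C *m X *m u) j 0 + dot u x * xi j 0.
Proof.
move=> X_sym; rewrite /dot /lin_hx mulmxDr -scalemxAr.
have -> : u^T *m (X *m (row j C)^T) = (row j (C *m X *m u))^T.
  by rewrite !row_mul !trmx_mul X_sym.
rewrite mxE [in LHS]mxE [in LHS]mxE [X in _ + X]mxE.
by rewrite [_ * xi _ _]mulrC.
Qed.

Theorem corollary5p2 (R : realType) (n l : nat)
    (Q : 'I_l -> 'M[R]_n) (c : 'I_l -> 'cV[R]_n) (d : 'I_l -> R)
    (Q_sym : forall i : 'I_l, (Q i)^T = Q i)
    (u : 'cV[R]_n) (u_gt0 : forall j : 'I_n, 0 < u j 0)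
    (alpha : R) (alpha_gt0 : 0 < alpha)
    (p : nat) (C : 'M[R]_(p, n)) (xi : 'cV[R]_p)
    (zeta : 'cV[R]_n) (eta : 'cV[R]_#|nonconvex Q|) (theta : R)
    (gsoc : is_gsoc c d C xi zeta eta theta)
    (x : 'cV[R]_n) (x_ge0 : forall j : 'I_n, 0 <= x j 0)
    (ux_le : dot u x <= alpha)
    (z : 'cV[R]_#|nonconvex Q|)
    (X : 'M[R]_n) (X_sym : X^T = X) (S : 'M[R]_(n, #|nonconvex Q|))
    (gsrt_x : forall j : 'I_n,
       enorm (C *m col j X + x j 0 *: xi)
         <= lin_lx zeta eta theta x X S j 0)
    (gsrt_u :
       enorm (alpha *: (C *m x + xi) - C *m X *m u - dot u x *: xi)
         <= alpha * affine_l zeta eta theta x z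
            - dot u (lin_lx zeta eta theta x X S)) :
  psd (ksoc_mx u alpha C xi zeta eta theta x z X S).
Proof.
rewrite /ksoc_mx; apply: psd_arrow_blocks => [i|i|].
- exact: ltW.
- by rewrite col_lin_hx.
suff -> : \col_j (alpha * ((row j C *m x) 0 0 + xi j 0)
                  - dot u (lin_hx C xi x X j))
    = alpha *: (C *m x + xi) - C *m X *m u - dot u x *: xi by [].
apply/colP => j; rewrite mxE dot_lin_hx // opprD addrA -row_mul.
by rewrite !mxE.
Qed.
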